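(* Let $A$ be a finite left-symmetric conformal algebra which is free as a $\mathbb{C}[\partial]$-module and let $r\in A\otimes A$ be symmetric. Let $T\in\mathrm{Chom}(A^{*c},A)$ be the conformal linear map corresponding to $r$ and $T_0=T_\lambda|_{\lambda=0}$. Then $r$ is a solution of the conformal $S$-equation in $A$ if and only if $$[T_0(a^* )_\lambda T_0(b^* )]=T_0\big(L_A^*(T_0(a^* ))_\lambda b^*-L_A^*(T_0(b^* ))_{-\lambda-\partial}a^*\big)\qquad\text{for all }a^*,b^*\in A^{*c}.$$
   Context: A left-symmetric conformal algebra is a $\mathbb{C}[\partial]$-module $A$ with a $\mathbb{C}$-bilinear map $A\times A\to A[\lambda]$, $(a,b)\mapsto a_\lambda b$, such that $(\partial a)_\lambda b=-\lambda a_\lambda b$, $a_\lambda(\partial b)=(\partial+\lambda)a_\lambda b$ and $(a_\lambda b)_{\lambda+\mu}c-a_\lambda(b_\mu c)=(b_\mu a)_{\lambda+\mu}c-b_\mu(a_\lambda c)$. It is finite if finitely generated over $\mathbb{C}[\partial]$. The bracket $[a_\lambda b]=a_\lambda b-b_{-\lambda-\partial}a$ makes $A$ a Lie conformal algebra $\mathfrak{g}(A)$ (sub-adjacent Lie conformal algebra). Convention: substituting $-\lambda-\partial$ for $\lambda$ in $\sum_n\lambda^nc_n$ gives $\sum_n(-\lambda-\partial)^nc_n$, with $\partial$ acting on the coefficients; linear maps are extended to polynomials coefficientwise. Tensor products are over $\mathbb{C}$. The conformal dual $A^{*c}$ is the set of $\mathbb{C}$-linear maps $f_\lambda:A\to\mathbb{C}[\lambda]$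 with $f_\lambda(\partial a)=\lambda f_\lambda(a)$, with $(\partial f)_\lambda=-\lambda f_\lambda$. $\mathrm{Chom}(A^{*c},A)$ is the set of $\mathbb{C}$-linear maps $T_\lambda:A^{*c}\to A[\lambda]$ with $T_\lambda(\partial f)=(\partial+\lambda)T_\lambda(f)$. The dual of the regular representation $L_A(a)_\lambda b=a_\lambda b$ of $\mathfrak{g}(A)$ is $(L_A^*(a)_\lambda f)_\mu b=-f_{\mu-\lambda}(a_\lambda b)$. For $r=\sum_ir_i\otimes l_i\in A\otimes A$: $r^{21}=\sum_il_i\otimes r_i$, and $r$ is symmetric if $r=r^{21}$. The map $T\in\mathrm{Chom}(A^{*c},A)$ corresponding to $r$ is $T_\lambda(f)=\sum_if_{-\lambda-\partial}(r_i)\,l_i$ (the polynomial $f_x(r_i)$ is evaluated at $x=-\lambda-\partial$, with $\partial$ acting on $l_i$). The conformal $S$-equation for $r=\sum_ir_i\otimes l_i$ in $A$ is $$\sum_{i,j}({l_j}_\mu r_i\otimes r_j\otimes l_i)|_{\mu=1\otimes\partial\otimes1}-\sum_{i,j}(r_j\otimes{l_j}_\mu r_i\otimes l_i)|_{\mu=\partial\otimes1\otimes1}-\sum_{i,j}(r_i\otimes r_j\otimes[{l_i}_\mu l_j])|_{\mu=\partial\otimes1\otimes1}=0\mod(\partial^{\otimes^3})$$ in $A\otimes A\otimes A$, where $\partial^{\otimes^3}=\partial\otimes1\otimes1+1\otimes\partial\otimes1+1\otimes1\otimes\partial$, ''mod $(\partial^{\otimes^3})$'' means modulo $\partial^{\otimes^3}(A\otimes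 A\otimes A)$, and the subscript means each power $\mu^n$ is replaced by the $n$-th power of the indicated operator. *)

(* Defs.v *)
From HB Require Import structures.
From mathcomp Require Import all_boot all_order all_algebra.
From mathcomp Require Import generic_quotient ring_quotient.
From mathcomp Require Import finmap.
From mathcomp.multinomials Require Import monalg.
From mathcomp Require Import boolp reals complex.

Set Implicit Arguments.
Unset Strict Implicit.
Unset Printing Implicit Defensive.

Import GRing.Theory.
Local Open Scope ring_scope.
Local Open Scope quotient_scope.

Section LinearFacts.
Variables (K : pzRingType) (U V : lmodType K) (f : U -> V).
Hypothesis fl : linear f.

Lemma lin0 : f 0 = 0.
Proof. by have := fl (-1) 0 0; rewrite scaler0 addr0 scaleN1r addNr. Qed.

Lemma linD x y : f (x + y) = f x + f y.
Proof. by rewrite -[x in LHS]scale1r fl scale1r. Qed.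

Lemma linZ c x : f (c *: x) = c *: f x.
Proof. by rewrite -[c *: x]addr0 fl lin0 addr0. Qed.

End LinearFacts.

(* ------------------------------------------------------------------------ *)
(* U ⊗ V over a field K: the free K-module on the pairs (u, v), modulo the    *)
(* submodule generated by the bilinearity relations.                         *)

Section Tensor.
Variables (K : fieldType) (U V : lmodType K).

Local Notation free := {malg K[(U * V)%type]}.
Local Notation gen u v := (<< (u, v) >> : free).

Inductive bilin_rel : free -> Prop :=
| bilin_rel0 : bilin_rel 0
| bilin_relD x y : bilin_rel x -> bilin_rel y -> bilin_rel (x + y)
| bilin_relZ c x : bilin_rel x -> bilin_rel (c *: x)
| bilin_relDl u u' v : bilin_rel (gen (u + u') v - gen u v - gen u' v)
| bilin_relDr u v v' : bilin_rel (gen u (v + v') - gen u v - gen u v')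
| bilin_relZl c u v : bilin_rel (gen (c *: u) v - c *: gen u v)
| bilin_relZr c u v : bilin_rel (gen u (c *: v) - c *: gen u v).

Definition bilin_pred : {pred free} := fun x => `[< bilin_rel x >].

Lemma bilin_predP x : reflect (bilin_rel x) (x \in bilin_pred).
Proof. exact: asboolP. Qed.

Fact bilin_zmod_closed : zmod_closed bilin_pred.
Proof.
split=> [|x y /bilin_predP xP /bilin_predP yP]; apply/bilin_predP.
  exact: bilin_rel0.
by apply: bilin_relD => //; rewrite -scaleN1r; apply: bilin_relZ.
Qed.

HB.instance Definition _ :=
  GRing.isZmodClosed.Build free bilin_pred bilin_zmod_closed.

Definition tensor : Type := Quotient.quot bilin_pred.

HB.instance Definition _ := GRing.Zmodule.on tensor.
HB.instance Definition _ := EqQuotient.on tensor.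

Lemma tens_eqP (x y : free) :
  reflect (\pi_tensor x = \pi_tensor y) (x - y \in bilin_pred).
Proof. by rewrite Quotient.idealrBE; apply: eqP. Qed.

Lemma pi_tensorD (x y : free) :
  \pi_tensor (x + y) = \pi_tensor x + \pi_tensor y.
Proof. exact: Quotient.pi_add. Qed.

Definition tensor_scale (c : K) (t : tensor) : tensor :=
  \pi_tensor (c *: repr t).

Lemma pi_tensorZ c (x : free) :
  tensor_scale c (\pi_tensor x) = \pi_tensor (c *: x).
Proof.
apply/tens_eqP; rewrite -scalerBr; apply/bilin_predP/bilin_relZ/bilin_predP.
by apply/tens_eqP; rewrite reprK.
Qed.

Fact tensor_scaleA a b t :
  tensor_scale a (tensor_scale b t) = tensor_scale (a * b) t.
Proof. by elim/quotW: t => x; rewrite (pi_tensorZ b x) !pi_tensorZ scalerA. Qed.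

Fact tensor_scale1 : left_id 1 tensor_scale.
Proof. by elim/quotW=> x; rewrite pi_tensorZ scale1r. Qed.

Fact tensor_scaleDr : right_distributive tensor_scale +%R.
Proof.
move=> c; elim/quotW=> x; elim/quotW=> y.
by rewrite -pi_tensorD !pi_tensorZ scalerDr pi_tensorD.
Qed.

Fact tensor_scaleDl t : {morph tensor_scale^~ t : a b / a + b}.
Proof.
by elim/quotW: t => x a b; rewrite !pi_tensorZ scalerDl pi_tensorD.
Qed.

HB.instance Definition _ := GRing.Zmodule_isLmodule.Build K tensor
  tensor_scaleA tensor_scale1 tensor_scaleDr tensor_scaleDl.

Definition tens (u : U) (v : V) : tensor := \pi_tensor (gen u v).

Lemma pi_tensor_is_linear : linear (\pi_tensor : free -> tensor).
Proof. by move=> c x y; rewrite pi_tensorD -pi_tensorZ. Qed.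

Lemma tens_linearl v : linear (tens^~ v).
Proof.
move=> c u u'; rewrite /tens -pi_tensor_is_linear; apply/tens_eqP/bilin_predP.
have := bilin_relD (bilin_relDl (c *: u) u' v) (bilin_relZl c u v).
by rewrite addrA [_ - _ - _ + _]addrAC subrK addrAC -addrA -opprD.
Qed.

Lemma tens_linearr u : linear (tens u).
Proof.
move=> c v v'; rewrite /tens -pi_tensor_is_linear; apply/tens_eqP/bilin_predP.
have := bilin_relD (bilin_relDr u (c *: v) v') (bilin_relZr c u v).
by rewrite addrA [_ - _ - _ + _]addrAC subrK addrAC -addrA -opprD.
Qed.

Lemma freeE (x : free) : x = \sum_(k <- msupp x) x@_k *: gen k.1 k.2.
Proof.
rewrite [LHS]monalgE; apply: eq_bigr => -[u v] _ /=.
by apply/malgP=> k; rewrite mcoeffZ !mcoeffU mulrnAr mulr1.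
Qed.

HB.instance Definition _ :=
  GRing.isLinear.Build K free tensor _ (\pi_tensor) pi_tensor_is_linear.

Lemma tensorP (t : tensor) :
  exists (m : nat) (u : 'I_m -> U) (v : 'I_m -> V),
    t = \sum_(i < m) tens (u i) (v i).
Proof.
elim/quotW: t => x; set s := in_tuple (msupp x).
exists (size (msupp x)), (fun i => x@_(tnth s i) *: (tnth s i).1).
exists (fun i => (tnth s i).2).
rewrite {1}[x]freeE linear_sum /= big_tnth; apply: eq_bigr => i _.
rewrite linearZ /=.
exact/esym/(linZ (tens_linearl (tnth s i).2)).
Qed.

(* Meaningful for bilinear phi, see tlift_tens and tlift_linear. *)
Definition tlift (W : lmodType K) (phi : U -> V -> W) (t : tensor) : W :=
  \sum_(k <- msupp (repr t)) (repr t)@_k *: phi k.1 k.2.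

Section Lift.
Variables (W : lmodType K) (phi : U -> V -> W).
Hypotheses (phil : forall v, linear (phi^~ v)) (phir : forall u, linear (phi u)).

Let Phi (x : free) : W := \sum_(k <- msupp x) x@_k *: phi k.1 k.2.

Let PhiEw (x : free) (d : {fset (U * V)%type}) : (msupp x `<=` d)%fset ->
  Phi x = \sum_(k <- d) x@_k *: phi k.1 k.2.
Proof.
move=> /fsubsetP sd; rewrite /Phi [RHS](bigID (mem (msupp x))) /=.
rewrite [X in _ = _ + X]big1 ?addr0; last first.
  by move=> k /mcoeff_outdom ->; rewrite scale0r.
rewrite -[RHS]big_filter; apply: perm_big.
apply: uniq_perm; rewrite ?filter_uniq ?fset_uniq // => k.
by rewrite mem_filter; case: (boolP (k \in msupp x)) => //= /sd ->.
Qed.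

Let Phi_linear : linear Phi.
Proof.
move=> c x y; set d := (msupp x `|` msupp y `|` msupp (c *: x + y))%fset.
have sx : (msupp x `<=` d)%fset by rewrite /d -!fsetUA; apply: fsubsetUl.
have sy : (msupp y `<=` d)%fset by rewrite /d fsetUAC; apply: fsubsetUr.
have sz : (msupp (c *: x + y) `<=` d)%fset by apply: fsubsetUr.
rewrite (PhiEw sx) (PhiEw sy) (PhiEw sz).
rewrite scaler_sumr -big_split; apply: eq_bigr => k _ /=.
by rewrite mcoeffD mcoeffZ scalerDl scalerA.
Qed.

Let PhiU u v : Phi (gen u v) = phi u v.
Proof.
rewrite /Phi msuppU oner_eq0 big_seq_fset1.
by rewrite mcoeffUU scale1r.
Qed.

Let Phi_rel x : bilin_rel x -> Phi x = 0.
Proof.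
pose F : {linear free -> W} :=
  HB.pack Phi (GRing.isLinear.Build K free W _ Phi Phi_linear).
rewrite -[Phi]/(F : free -> W).
elim=> [|y z _ yP _ zP|c y _ yP|u u' v|u v v'|c u v|c u v].
- by rewrite linear0.
- by rewrite linearD yP zP addr0.
- by rewrite linearZ_LR yP scaler0.
- by rewrite !linearB /= !PhiU (linD (phil v)) addrAC addrK subrr.
- by rewrite !linearB /= !PhiU (linD (phir u)) addrAC addrK subrr.
- by rewrite linearB linearZ_LR /= !PhiU (linZ (phil v)) subrr.
- by rewrite linearB linearZ_LR /= !PhiU (linZ (phir u)) subrr.
Qed.

Let tlift_pi x : tlift phi (\pi_tensor x) = Phi x.
Proof.
have /bilin_predP/Phi_rel : repr (\pi_tensor x) - x \in bilin_pred.
  by apply/tens_eqP; rewrite reprK.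
rewrite -scaleN1r addrC Phi_linear scaleN1r => /eqP.
by rewrite addrC subr_eq0 => /eqP.
Qed.

Lemma tlift_linear : linear (tlift phi).
Proof.
move=> c; elim/quotW=> x; elim/quotW=> y.
by rewrite -pi_tensor_is_linear !tlift_pi Phi_linear.
Qed.

Lemma tlift_tens u v : tlift phi (tens u v) = phi u v.
Proof. by rewrite tlift_pi PhiU. Qed.

End Lift.
End Tensor.

(* f ⊗ g, for linear f and g. *)
Definition tmap (K : fieldType) (U V U' V' : lmodType K)
    (f : U -> U') (g : V -> V') : tensor U V -> tensor U' V' :=
  tlift (fun u v => tens (f u) (g v)).

Section TensorMap.
Variables (K : fieldType) (U V U' V' : lmodType K).
Variables (f : U -> U') (g : V -> V').
Hypotheses (fl : linear f) (gl : linear g).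

Let tmapl v : linear (fun u => tens (f u) (g v)).
Proof. by move=> c u u'; rewrite fl tens_linearl. Qed.

Let tmapr u : linear (fun v => tens (f u) (g v)).
Proof. by move=> c v v'; rewrite gl tens_linearr. Qed.

Lemma tmap_linear : linear (tmap f g).
Proof. exact: tlift_linear. Qed.

Lemma tmap_tens u v : tmap f g (tens u v) = tens (f u) (g v).
Proof. exact: (tlift_tens tmapl tmapr). Qed.

End TensorMap.

(* ------------------------------------------------------------------------ *)
(* V[λ] is represented by the finitely supported maps nat -> V, the          *)
(* coefficient of λ^n in p being p@_n; V[λ][μ] is (V[λ])[μ].                 *)

Notation pol V := {malg V[nat]}.

Section Polynomials.
Variables V W : zmodType.

Definition pol_const (v : V) : pol V := << v *g 0%N >>.

Definition pol_X (p : pol V) : pol V :=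
  \sum_(n <- msupp p) << p@_n *g n.+1 >>.

Definition pol_map (f : V -> W) (p : pol V) : pol W :=
  \sum_(n <- msupp p) << f p@_n *g n >>.

(* \sum_n λ^n c_n  |->  \sum_n D^n (f c_n) *)
Definition pol_subst (D : W -> W) (f : V -> W) (p : pol V) : W :=
  \sum_(n <- msupp p) iter n D (f p@_n).

End Polynomials.

Section TwoVariables.
Variable V : zmodType.

(* Multiplication by λ and by μ on V[λ][μ], and the substitutions of λ, of μ *)
(* and of λ + μ for the variable of a polynomial over V.                     *)
Definition lam2 : pol (pol V) -> pol (pol V) := pol_map (@pol_X V).
Definition mu2 : pol (pol V) -> pol (pol V) := @pol_X (pol V).
Definition pol_const2 (v : V) : pol (pol V) := pol_const (pol_const v).
Definition in_lam : pol V -> pol (pol V) := pol_subst lam2 pol_const2.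
Definition in_mu : pol V -> pol (pol V) := pol_subst mu2 pol_const2.
Definition in_lamDmu : pol V -> pol (pol V) :=
  pol_subst (fun q => lam2 q + mu2 q) pol_const2.

End TwoVariables.

(* ------------------------------------------------------------------------ *)

Section Modules.
Variables (K : fieldType) (A : lmodType {poly K}).

Definition pd (a : A) : A := 'X *: a.

(* The K[∂]-module A, as a vector space over K. *)
Definition vsp : Type := A.

HB.instance Definition _ := GRing.Zmodule.on vsp.

Definition vsp_scale (c : K) (a : vsp) : vsp := c%:P *: (a : A).

Fact vsp_scaleA a b v : vsp_scale a (vsp_scale b v) = vsp_scale (a * b) v.
Proof. by rewrite /vsp_scale scalerA polyCM. Qed.

Fact vsp_scale1 : left_id 1 vsp_scale.
Proof. by move=> v; rewrite /vsp_scale scale1r. Qed.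

Fact vsp_scaleDr : right_distributive vsp_scale +%R.
Proof. by move=> c u v; rewrite /vsp_scale scalerDr. Qed.

Fact vsp_scaleDl v : {morph vsp_scale^~ v : a b / a + b}.
Proof. by move=> a b; rewrite /vsp_scale polyCD scalerDl. Qed.

HB.instance Definition _ := GRing.Zmodule_isLmodule.Build K vsp
  vsp_scaleA vsp_scale1 vsp_scaleDr vsp_scaleDl.

Definition finitely_generated : Prop :=
  exists (n : nat) (e : 'I_n -> A), forall a : A,
    exists p : 'I_n -> {poly K}, a = \sum_(i < n) p i *: e i.

(* A has a basis, possibly infinite: every element is a unique finite linear *)
(* combination of the e i.                                                   *)
Definition is_free : Prop :=
  exists (I : choiceType) (e : I -> A), forall a : A,
    exists! p : {malg {poly K}[I]}, a = \sum_(i <- msupp p) p@_i *: e i.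

(* -λ - ∂ acting on A[λ], and the substitution of -λ - ∂ for λ *)
Definition mlam_pd (p : pol A) : pol A := - pol_X p - pol_map pd p.

Definition subst_mlam_pd : pol A -> pol A := pol_subst mlam_pd (@pol_const A).

(* mul a b is a_λ b *)
Variable mul : A -> A -> pol A.

Record is_lsca : Prop := IsLSCA {
  lsca_linearl : forall c a a' b,
    mul (c%:P *: a + a') b = pol_map ( *:%R c%:P) (mul a b) + mul a' b;
  lsca_linearr : forall c a b b',
    mul a (c%:P *: b + b') = pol_map ( *:%R c%:P) (mul a b) + mul a b';
  lsca_pdl : forall a b, mul (pd a) b = - pol_X (mul a b);
  lsca_pdr : forall a b, mul a (pd b) = pol_map pd (mul a b) + pol_X (mul a b);
  lsca_left_sym : forall a b c,
    pol_subst (@lam2 A) (fun x => in_lamDmu (mul x c)) (mul a b)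
      - pol_subst (@mu2 A) (fun x => in_lam (mul a x)) (mul b c)
    = pol_subst (@mu2 A) (fun x => in_lamDmu (mul x c)) (mul b a)
      - pol_subst (@lam2 A) (fun x => in_mu (mul b x)) (mul a c)
}.

Definition bracket (a b : A) : pol A := mul a b - subst_mlam_pd (mul b a).

(* A^{*c}: f_λ(a) is written f a, with λ the variable of {poly K}. *)
Definition is_cdual (f : A -> {poly K}) : Prop :=
  (forall c a b, f (c%:P *: a + b) = c *: f a + f b)
  /\ (forall a, f (pd a) = 'X * f a).

(* An element F_λ of A^{*c}[λ] is represented by b |-> (F_λ)_μ b in           *)
(* K[μ][λ]: the coefficient of λ^n in F_λ is b |-> (F b)`_n. Such an F does   *)
(* come from A^{*c}[λ] when is_cdual_pol F holds (see Ldual_cdual_pol and    *)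
(* dual_subst_Ldual_cdual_pol below).                                        *)
Definition lamP : {poly {poly K}} := 'X.
Definition muP : {poly {poly K}} := 'X%:P.

(* L_A^*(a)_λ f *)
Definition Ldual (a : A) (f : A -> {poly K}) (b : A) : {poly {poly K}} :=
  - pol_subst ( *%R lamP)
      (fun x => (map_poly (polyC \o polyC) (f x)).[muP - lamP]) (mul a b).

(* F_{-λ-∂}, where ∂ acts on A^{*c} by (∂ f)_μ = - μ f_μ *)
Definition dual_subst (F : A -> {poly {poly K}}) (b : A) : {poly {poly K}} :=
  F b \Po (- lamP - (- muP)).

Definition coef_lam (F : A -> {poly {poly K}}) (n : nat) (b : A) : {poly K} :=
  (F b)`_n.

Definition is_cdual_pol (F : A -> {poly {poly K}}) : Prop :=
  (forall n, is_cdual (coef_lam F n))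
  /\ exists N : nat, forall b, (size (F b) <= N)%N.

Section Family.
(* The representation \sum_i r_i ⊗ l_i of an element of A ⊗ A *)
Variables (m : nat) (r l : 'I_m -> A).

Definition Tlam (f : A -> {poly K}) : pol A :=
  \sum_(i < m) \sum_(k < size (f (r i)))
     pol_map ( *:%R ((f (r i))`_k)%:P) (iter k mlam_pd (pol_const (l i))).

(* T_λ at λ = 0. It is given by the same formula on all maps A -> K[λ].      *)
Definition T0 (f : A -> {poly K}) : A := (Tlam f)@_0%N.

Definition AA := tensor vsp vsp.
Definition AAA := tensor AA vsp.

Definition t3 (a b c : A) : AAA := tens (tens (a : vsp) (b : vsp)) (c : vsp).

Let pdv : vsp -> vsp := pd.
Definition pd1 : AAA -> AAA := tmap (tmap pdv id) id.
Definition pd2 : AAA -> AAA := tmap (tmap id pdv) id.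
Definition pd3 : AAA -> AAA := tmap id pdv.
Definition pd_sum (x : AAA) : AAA := pd1 x + pd2 x + pd3 x.

(* pol_subst pd2 replaces μ^n by the n-th power of 1⊗∂⊗1, and so on. *)
Definition conformal_S_equation : Prop := exists x : AAA,
  \sum_(i < m) \sum_(j < m)
      pol_subst pd2 (fun c => t3 c (r j) (l i)) (mul (l j) (r i))
  - \sum_(i < m) \sum_(j < m)
      pol_subst pd1 (fun c => t3 (r j) c (l i)) (mul (l j) (r i))
  - \sum_(i < m) \sum_(j < m)
      pol_subst pd1 (fun c => t3 (r i) (r j) c) (bracket (l i) (l j))
  = pd_sum x.

End Family.
End Modules.

(* ------------------------------------------------------------------------ *)

Section SubstFacts.
Variables (V W : zmodType) (D : {additive W -> W}).

Lemma iterD_additive n : additive (iter n D).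
Proof.
by elim: n => [|n IH] x y //=; rewrite IH raddfB.
Qed.

Variable f : {additive V -> W}.

Lemma pol_substEw p (d : {fset nat}) : (msupp p `<=` d)%fset ->
  pol_subst D f p = \sum_(n <- d) iter n D (f p@_n).
Proof.
move=> /fsubsetP sd; rewrite /pol_subst [RHS](bigID (mem (msupp p))) /=.
rewrite [X in _ = _ + X]big1 ?addr0; last first.
  move=> k /mcoeff_outdom ->; rewrite raddf0.
  by have := iterD_additive k 0 0; rewrite !subr0 subrr => ->.
rewrite -[RHS]big_filter; apply: perm_big.
apply: uniq_perm; rewrite ?filter_uniq ?fset_uniq // => k.
by rewrite mem_filter; case: (boolP (k \in msupp p)) => //= /sd ->.
Qed.

Lemma pol_subst_additive : additive (pol_subst D f).
Proof.
move=> p q; set d := (msupp p `|` msupp q `|` msupp (p - q))%fset.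
have sp : (msupp p `<=` d)%fset by rewrite /d -!fsetUA; apply: fsubsetUl.
have sq : (msupp q `<=` d)%fset by rewrite /d fsetUAC; apply: fsubsetUr.
have spq : (msupp (p - q) `<=` d)%fset by apply: fsubsetUr.
rewrite (pol_substEw sp) (pol_substEw sq) (pol_substEw spq) -sumrB.
by apply: eq_bigr => k _; rewrite mcoeffB raddfB iterD_additive.
Qed.

HB.instance Definition _ :=
  GRing.isZmodMorphism.Build _ _ (pol_subst D f) pol_subst_additive.

Lemma pol_substU v n : pol_subst D f << v *g n >> = iter n D (f v).
Proof.
by rewrite (pol_substEw msuppU_le) big_seq_fset1 mcoeffUU.
Qed.

Lemma pol_substX p : pol_subst D f (pol_X p) = D (pol_subst D f p).
Proof.
rewrite /pol_X raddf_sum /= [in RHS]/pol_subst raddf_sum.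
by apply: eq_bigr => k _; rewrite pol_substU.
Qed.
End SubstFacts.

Lemma pol_subst_map (V W : zmodType) (D : {additive W -> W})
  (f : {additive V -> W}) (g : V -> V) p :
  pol_subst D f (pol_map g p) = pol_subst D (f \o g) p.
Proof.
by rewrite /pol_map raddf_sum /=; apply: eq_bigr => k _; rewrite pol_substU.
Qed.

Lemma is_cdualZ (K : fieldType) (A : lmodType {poly K}) (f : A -> {poly K}) :
  is_cdual f -> forall p a, f (p *: a) = p * f a.
Proof.
move=> [fl fX]; have f0 : f 0 = 0.
  by have := fl (-1) 0 0; rewrite scaler0 addr0 scaleN1r addNr.
elim/poly_ind=> [|p c IH] a; first by rewrite scale0r mul0r.
by rewrite addrC scalerDl fl mulrC -scalerA fX IH mulrDl mul_polyC mulrA.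
Qed.

Section DualPolynomials.
Variables (K : fieldType) (A : lmodType {poly K}) (mul : A -> A -> pol A).
Hypothesis mulP : is_lsca mul.

Section LdualFacts.
Variables (a : A) (f : A -> {poly K}).
Hypothesis fP : is_cdual f.

Local Notation muP := (muP K).
Let h x := (map_poly (polyC \o polyC) (f x)).[muP - 'X].

Let h_additive : additive h.
Proof.
move=> x y; have fl := fP.1; rewrite /h.
have -> : f (x - y) = f x - f y.
  by rewrite -scaleN1r -[-1]/(- 1%:P) -polyCN addrC fl scaleN1r addrC.
by rewrite raddfB /= hornerD hornerN.
Qed.

Let hA : {additive A -> {poly {poly K}}} :=
  HB.pack h (GRing.isZmodMorphism.Build _ _ h h_additive).

Let mulam_additive : additive (fun q : {poly {poly K}} => lamP K * q).
Proof. by move=> x y; rewrite mulrBr. Qed.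

Let D : {additive {poly {poly K}} -> {poly {poly K}}} :=
  HB.pack ( *%R (lamP K)) (GRing.isZmodMorphism.Build _ _ _ mulam_additive).

Let LdualE b : Ldual mul a f b = - pol_subst D hA (mul a b).
Proof. by []. Qed.


Let hZ c x : h (c%:P *: x) = c%:P%:P * h x.
Proof.
by rewrite /h (is_cdualZ fP) rmorphM hornerM /= map_polyC hornerC.
Qed.

Let hX x : h (pd x) = (muP - 'X) * h x.
Proof.
by rewrite /h (is_cdualZ fP) rmorphM hornerM /= map_polyX hornerX.
Qed.

Let substD p q :
  pol_subst D hA (p + q) = pol_subst D hA p + pol_subst D hA q.
Proof. exact: raddfD. Qed.

Lemma Ldual_lin c b b' :
  Ldual mul a f (c%:P *: b + b') = c%:P%:P * Ldual mul a f b + Ldual mul a f b'.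
Proof.
rewrite !LdualE (lsca_linearr mulP) substD.
rewrite pol_subst_map opprD mulrN.
congr (- _ - _); rewrite /pol_subst mulr_sumr; apply: eq_bigr => k _ /=.
rewrite hZ; move: (h _) => v; elim: k => [//|k IH] /=.
by rewrite IH mulrCA.
Qed.

Lemma Ldual_pd b : Ldual mul a f (pd b) = muP * Ldual mul a f b.
Proof.
rewrite !LdualE (lsca_pdr mulP) substD.
rewrite pol_subst_map pol_substX.
have -> : pol_subst D (hA \o pd (A:=A)) (mul a b) =
   (muP - 'X) * pol_subst D hA (mul a b).
  rewrite /pol_subst mulr_sumr; apply: eq_bigr => k _ /=.
  rewrite hX; move: (h _) => v; elim: k => [//|k IH] /=.
  by rewrite IH mulrCA.
by rewrite -mulrDl subrK mulrN.
Qed.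

End LdualFacts.

Section Semilinear.
Variable F : A -> {poly {poly K}}.
Hypothesis F_lin : forall c b b', F (c%:P *: b + b') = c%:P%:P * F b + F b'.
Hypothesis F_pd : forall b, F (pd b) = muP K * F b.

Lemma dual_subst_lin c b b' :
  dual_subst F (c%:P *: b + b') = c%:P%:P * dual_subst F b + dual_subst F b'.
Proof. by rewrite /dual_subst F_lin comp_polyD comp_polyM comp_polyC. Qed.

Lemma dual_subst_pd b : dual_subst F (pd b) = muP K * dual_subst F b.
Proof. by rewrite /dual_subst F_pd comp_polyM comp_polyC. Qed.

Let F0 : F 0 = 0.
Proof.
have := F_lin (-1) 0 0; rewrite scaler0 addr0 !polyCN mulN1r.
by rewrite addNr.
Qed.

Let FD b b' : F (b + b') = F b + F b'.
Proof. by have := F_lin 1 b b'; rewrite scale1r mul1r. Qed.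

Let FZ p b : F (p *: b) = p%:P * F b.
Proof.
elim/poly_ind: p b => [|p c IH] b; first by rewrite scale0r F0 polyC0 mul0r.
rewrite addrC scalerDl F_lin mulrC -scalerA mulrC IH F_pd.
by rewrite polyCD polyCM mulrDl mulrA.
Qed.

Lemma semilinear_cdual_pol : finitely_generated A -> is_cdual_pol F.
Proof.
move=> [m [e eP]]; split=> [n|].
  split=> [c b b'|b]; rewrite /coef_lam.
    by rewrite F_lin coefD mul_polyC coefZ mul_polyC.
  by rewrite F_pd /muP mul_polyC coefZ.
exists (\max_(i < m) size (F (e i))) => b; have [p ->] := eP b.
elim/big_rec: _ => [|i x _ IH]; first by rewrite F0 size_poly0.
rewrite FD (leq_trans (size_polyD _ _)) // geq_max IH andbT.
rewrite FZ mul_polyC (leq_trans (size_scale_leq _ _)) //.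
exact: (leq_bigmax (F := fun i => size (F (e i)))).
Qed.

End Semilinear.

Lemma Ldual_cdual_pol a f : finitely_generated A ->
  is_cdual f -> is_cdual_pol (Ldual mul a f).
Proof.
move=> fgA fP; apply: semilinear_cdual_pol => //.
  exact: Ldual_lin.
exact: Ldual_pd.
Qed.

Lemma dual_subst_Ldual_cdual_pol a f : finitely_generated A ->
  is_cdual f -> is_cdual_pol (dual_subst (Ldual mul a f)).
Proof.
move=> fgA fP; apply: semilinear_cdual_pol => //.
  by apply: dual_subst_lin; apply: Ldual_lin.
by apply: dual_subst_pd; apply: Ldual_pd.
Qed.

End DualPolynomials.

(* Main.v *)
Require Import Defs.
From HB Require Import structures.
From mathcomp Require Import all_boot all_order all_algebra.
From mathcomp Require Import finmap.
From mathcomp Require Import boolp reals complex.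
From mathcomp.multinomials Require Import monalg.
Import GRing.Theory.
Local Open Scope ring_scope.

Set Implicit Arguments.
Unset Strict Implicit.
Unset Printing Implicit Defensive.

(** For functionals [f] and [g] in the conformal dual, consider the map
    a (x) b (x) c  |->  f_lam(a) g_{-lam-pd}(b) c
from A (x) A (x) A to A[lam], where pd acts on c.  It turns the derivation of
the first factor into lam, that of the second one into -lam-pd and that of the
third one into pd.  Since these three add up to 0, the map is well defined
modulo the total derivation.

Applied to the left-hand side of the S-equation, it yields the difference
between the two sides of the operator identity for [f] and [g]
([eval_conformal_S_lhs]).  Indeed T_0(f) is the sum of the f_{-pd}(r_i) l_i, so
sesquilinearity moves the coefficients f_{-pd}(r_i) out of products and
brackets: [bracket_T0] gives the third sum of the S-equation and [dual_sideE]
the first two.  Hence the S-equation implies the operator identity.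

Conversely, the operator identity says that the left-hand side of the
S-equation is killed by all these maps, and they detect the elements outside
the image of the total derivation.  As A is free of finite rank, there are
elements e_i and functionals e'_i such that every a is the sum of the
e'_i(a) e_i ([free_dual_basis]).  Modulo the total derivation, the derivation
of the second factor can be traded for minus the sum of the other two, so an
element x of A (x) A (x) A is recovered from its images under the maps
attached to the pairs (e'_i, e'_j) by substituting the first derivation for
lam in sum_n lam^n c_n and putting e_i (x) e_j in front of the coefficients
([eq_mod_pd_reconstruct]).  If all these images vanish, x is a total
derivative.

All polynomial bookkeeping is done by regarding A[lam] as a module over
K[mu][lam], where lam is the variable and mu acts as -pd: then f_{-pd}(a),
f_lam(a) and f_{-lam-pd}(a) are the values of one polynomial at mu, lam and
mu - lam. *)

(** * Polynomials in an endomorphism *)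

Section PolynomialAction.
Variables (R : nzRingType) (V : lmodType R).

(** [V] with the action of K[X] in which X acts as a given endomorphism; the
alias carries the endomorphism so that distinct actions do not clash. *)
Definition endo_mod of {linear V -> V} : Type := V.

Variable phi : {linear V -> V}.
Local Notation Vphi := (endo_mod phi).

HB.instance Definition _ := GRing.Zmodule.on Vphi.

Definition endo_scale (p : {poly R}) (v : Vphi) : Vphi :=
  \sum_(i < size p) p`_i *: (iter i phi (v : V) : V).

Lemma endo_scaleEw n (p : {poly R}) v : (size p <= n)%N ->
  endo_scale p v = \sum_(i < n) p`_i *: iter i phi v.
Proof.
move=> szp; rewrite /endo_scale (big_ord_widen n (fun i => p`_i *: iter i phi v)) //.
rewrite big_mkcond; apply: eq_bigr => i _ /=.
by case: ltnP => // szi; rewrite (nth_default _ szi) scale0r.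
Qed.

Lemma iter_linear i : linear (iter i phi).
Proof. by move=> c u v; elim: i => //= i ->; rewrite linearP. Qed.

Lemma endo_scaleDl v : {morph endo_scale^~ v : p q / p + q}.
Proof.
move=> p q /=; set n := maxn (size p) (size q).
rewrite !(@endo_scaleEw n) ?leq_maxl ?leq_maxr ?size_polyD //.
by rewrite -big_split; apply: eq_bigr => i _; rewrite coefD scalerDl.
Qed.

Lemma endo_scaleDr : right_distributive endo_scale +%R.
Proof.
move=> p u v; rewrite /endo_scale -big_split /=; apply: eq_bigr => i _.
by rewrite (linD (iter_linear i)) scalerDr.
Qed.

Lemma endo_scaleC c v : endo_scale c%:P v = c *: (v : V).
Proof.
by rewrite (@endo_scaleEw 1) ?size_polyC_leq1 // big_ord1 coefC.
Qed.

Lemma endo_scaleXr p v : endo_scale (p * 'X) v = phi (endo_scale p v).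
Proof.
rewrite (@endo_scaleEw (size p).+1) ?size_polyMX_leq //; last first.
  by have [->|/size_mulX->] := eqVneq p 0; rewrite ?mul0r ?size_poly0.
rewrite big_ord_recl coefMX /= scale0r add0r [RHS]linear_sum /=.
by apply: eq_bigr => i _; rewrite coefMX /= linearZ.
Qed.

Lemma endo_scaleCl c p v : endo_scale (c%:P * p) v = c *: (endo_scale p v : V).
Proof.
rewrite (@endo_scaleEw (size p)); last by rewrite mul_polyC size_scale_leq.
by rewrite scaler_sumr; apply: eq_bigr => i _; rewrite coefCM scalerA.
Qed.

Lemma endo_scaleA p q v : endo_scale p (endo_scale q v) = endo_scale (p * q) v.
Proof.
elim/poly_ind: p => [|p c IH].
  by rewrite mul0r /endo_scale size_poly0 !big_ord0.
rewrite mulrDl !endo_scaleDl endo_scaleXr IH endo_scaleC endo_scaleCl.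
by rewrite -mulrA -commr_polyX mulrA endo_scaleXr.
Qed.

Lemma endo_scale1 : left_id 1 endo_scale.
Proof. by move=> v; rewrite endo_scaleC scale1r. Qed.

HB.instance Definition _ := GRing.Zmodule_isLmodule.Build {poly R} Vphi
  endo_scaleA endo_scale1 endo_scaleDr endo_scaleDl.

Lemma endo_modC c (v : Vphi) : c%:P *: v = c *: (v : V).
Proof. exact: endo_scaleC. Qed.

Lemma endo_modX (v : Vphi) : 'X *: v = phi v.
Proof. by rewrite -['X]mul1r [LHS]endo_scaleXr endo_scale1. Qed.

End PolynomialAction.

(** * The module A[lam] over K[mu][lam] *)

Section PolCoef.
Variables V W : zmodType.

Lemma mcoeff_reindex (f : V -> W) (s : nat -> nat) (p : pol V) n :
  f 0 = 0 -> injective s ->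
  (\sum_(k <- msupp p) << f p@_k *g s k >>)@_(s n) = f p@_n.
Proof.
move=> f0 s_inj; rewrite raddf_sum /=.
rewrite (eq_bigr (fun k => if k == n then f p@_n else 0)); last first.
  by move=> k _; rewrite mcoeffU (inj_eq s_inj); case: eqP => // ->.
case: (boolP (n \in msupp p)) => [pn|pn].
  rewrite (bigD1_seq n) ?fset_uniq //= eqxx big1 ?addr0 // => k.
  by move=> /negPf ->.
rewrite mcoeff_outdom // f0 big_seq big1 // => k kp.
by case: eqP kp pn => // -> ->.
Qed.

Lemma pol_mapE (f : V -> W) (p : pol V) n : f 0 = 0 ->
  (pol_map f p)@_n = f p@_n.
Proof. by move=> f0; apply: (@mcoeff_reindex f id). Qed.

End PolCoef.

Lemma pol_XE (V : zmodType) (p : pol V) n :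
  (pol_X p)@_n = if n is k.+1 then p@_k else 0.
Proof.
case: n => [|n]; last by apply: (@mcoeff_reindex V V id S) => //; apply: succn_inj.
by rewrite /pol_X raddf_sum /= big1 // => k _; rewrite mcoeffU.
Qed.

Section LambdaModule.
Variables (K : fieldType) (A : lmodType {poly K}).

(** A[lam] as a K[mu]-module with mu = -pd on coefficients.  The sign is chosen
because functionals enter T_0 evaluated at -pd. *)
Definition mu_mod : Type := pol A.

HB.instance Definition _ := GRing.Zmodule.on mu_mod.

Definition mu_scale (p : {poly K}) (q : mu_mod) : mu_mod :=
  pol_map ( *:%R (p \Po - 'X)) (q : pol A).

Lemma mu_scaleE p q n : (mu_scale p q : pol A)@_n = (p \Po - 'X) *: (q : pol A)@_n.
Proof. by rewrite /mu_scale pol_mapE ?scaler0. Qed.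

Fact mu_scaleA p p' q : mu_scale p (mu_scale p' q) = mu_scale (p * p') q.
Proof. by apply/malgP=> n; rewrite !mu_scaleE scalerA comp_polyM. Qed.

Fact mu_scale1 : left_id 1 mu_scale.
Proof. by move=> q; apply/malgP=> n; rewrite mu_scaleE comp_polyC scale1r. Qed.

Fact mu_scaleDr : right_distributive mu_scale +%R.
Proof.
by move=> p q q'; apply/malgP=> n; rewrite mcoeffD !mu_scaleE mcoeffD scalerDr.
Qed.

Fact mu_scaleDl q : {morph mu_scale^~ q : p p' / p + p'}.
Proof.
by move=> p p'; apply/malgP=> n; rewrite mcoeffD !mu_scaleE comp_polyD scalerDl.
Qed.

HB.instance Definition _ := GRing.Zmodule_isLmodule.Build {poly K} mu_mod
  mu_scaleA mu_scale1 mu_scaleDr mu_scaleDl.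

Fact pol_X_linear : linear (@pol_X A : mu_mod -> mu_mod).
Proof.
move=> p q q'; apply/malgP=> n; rewrite mcoeffD mu_scaleE !pol_XE.
by case: n => [|n]; rewrite ?scaler0 ?addr0 // mcoeffD mu_scaleE.
Qed.

HB.instance Definition _ :=
  GRing.isLinear.Build {poly K} mu_mod mu_mod _ (@pol_X A : mu_mod -> mu_mod) pol_X_linear.

(** The action of lam is added on top of that of mu. *)
Definition lam_mod : Type := endo_mod (@pol_X A : {linear mu_mod -> mu_mod}).

HB.instance Definition _ := GRing.Lmodule.on lam_mod.

Lemma lam_modX (q : lam_mod) : 'X *: q = pol_X (q : pol A).
Proof. exact: endo_modX. Qed.

Lemma lam_modCE p (q : lam_mod) n :
  (p%:P *: q : pol A)@_n = (p \Po - 'X) *: (q : pol A)@_n.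
Proof. by rewrite endo_modC mu_scaleE. Qed.

End LambdaModule.

Section Evaluation.
Variable K : fieldType.
Local Notation PP := {poly {poly K}}.

(** A polynomial over K evaluated at an element of K[mu][lam]: for a functional
h, [pev (lamP K) (h a)] is h_lam(a) and [pev (muP K - lamP K) (h a)] is
h_{mu-lam}(a). *)
Definition pev (x : PP) (p : {poly K}) : PP := (map_poly (polyC \o polyC) p).[x].

HB.instance Definition _ (x : PP) := GRing.RMorphism.copy (pev x)
  (horner_eval x \o map_poly (polyC \o polyC : {rmorphism K -> PP})).

Lemma pevC x c : pev x c%:P = c%:P%:P.
Proof. by rewrite /pev map_polyC hornerC. Qed.

Lemma pevX x : pev x 'X = x.
Proof. by rewrite /pev map_polyX hornerX. Qed.

Lemma pev_comp x y p : pev x p \Po y = pev (x \Po y) p.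
Proof.
elim/poly_ind: p => [|p c IH]; first by rewrite !rmorph0.
by rewrite !rmorphD !rmorphM /= !pevC !pevX comp_polyC IH.
Qed.

(** Substituting -lam-pd for lam is an involution. *)
Lemma muBlam_comp : (muP K - lamP K) \Po (muP K - lamP K) = lamP K.
Proof. by rewrite comp_polyB comp_polyC comp_polyX opprB addrC subrK. Qed.

End Evaluation.

Section Semilinear.
Variables (K : fieldType) (N : lmodType {poly {poly K}}).

(** The sesquilinearity axioms only mention constants and one variable; this is
their extension to arbitrary polynomials in that variable. *)
Lemma semilinear_poly (B : lmodType {poly {poly K}}) (h : {additive B -> N}) x z :
    (forall c b, h (c%:P%:P *: b) = c%:P%:P *: h b) ->
    (forall b, h (z *: b) = x *: h b) ->
  forall p b, h (pev z p *: b) = pev x p *: h b.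
Proof.
move=> hC hz; elim/poly_ind=> [|p c IH] b.
  by rewrite !rmorph0 !scale0r raddf0.
by rewrite !rmorphD !rmorphM /= !pevC !pevX !scalerDl raddfD hC -!scalerA IH hz.
Qed.

(** The form of sesquilinearity adapted to T_0, whose coefficients are
polynomials in -pd. *)
Lemma semilinear_pd (A : lmodType {poly K}) (h : {additive A -> N}) x :
    (forall c a, h (c%:P *: a) = c%:P%:P *: h a) ->
    (forall a, h (pd a) = - x *: h a) ->
  forall p a, h ((p \Po - 'X) *: a) = pev x p *: h a.
Proof.
move=> hC hX; elim/poly_ind=> [|p c IH] a.
  by rewrite !rmorph0 !scale0r raddf0.
rewrite !rmorphD !rmorphM /= !pevC !pevX comp_polyX comp_polyC !scalerDl raddfD hC.
by rewrite -!scalerA IH scaleNr raddfN hX scaleNr opprK.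
Qed.

End Semilinear.

Section LambdaModuleFacts.
Variables (K : fieldType) (A : lmodType {poly K}).
Local Notation PP := {poly {poly K}}.
Local Notation M := (lam_mod A).
Local Notation lam := (lamP K).
Local Notation mu := (muP K).

Definition lam_const (a : A) : M := pol_const a.

Fact lam_const_is_additive : zmod_morphism lam_const.
Proof. exact: monalgU_is_additive. Qed.

HB.instance Definition _ := GRing.isZmodMorphism.Build A M lam_const lam_const_is_additive.

Lemma lam_scale (q : M) : lam *: q = pol_X (q : pol A).
Proof. exact: lam_modX. Qed.

Lemma C_scale c (q : M) : c%:P%:P *: q = pol_map ( *:%R c%:P) (q : pol A).
Proof.
by apply/malgP=> n; rewrite lam_modCE comp_polyC pol_mapE ?scaler0.
Qed.

Lemma mu_scale_pd (q : M) : mu *: q = - pol_map (@pd K A) (q : pol A).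
Proof.
apply/malgP=> n; rewrite lam_modCE comp_polyX mcoeffN.
by rewrite pol_mapE /pd ?scaler0 // scaleNr.
Qed.

Lemma mlam_pdE (q : M) : mlam_pd (q : pol A) = (mu - lam) *: q.
Proof. by rewrite scalerBl lam_scale mu_scale_pd addrC. Qed.

Lemma lam_const_scale p a : lam_const ((p \Po - 'X) *: a) = p%:P *: lam_const a.
Proof.
apply/malgP=> n; rewrite lam_modCE !mcoeffU.
by case: eqP; rewrite ?scaler0.
Qed.

Lemma coef_scale_const (P : PP) a n :
  (P *: lam_const a : pol A)@_n = (P`_n \Po - 'X) *: a.
Proof.
elim/poly_ind: P n => [|P p IH] n.
  by rewrite scale0r coef0 comp_poly0 scale0r mcoeff0.
rewrite scalerDl mulrC -scalerA lam_scale -lam_const_scale mcoeffD pol_XE coefD.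
rewrite coefXM coefC comp_polyD scalerDl mcoeffU.
case: n => [|n] /=; first by rewrite comp_poly0 scale0r !add0r.
by rewrite IH comp_poly0 scale0r !addr0.
Qed.

(** Every substitution for lam that occurs below has values in some module over
K[mu][lam], and the substituted operator is the action of a scalar [x]. *)
Definition lam_eval (N : lmodType PP) (x : PP) (f : A -> N) (q : pol A) : N :=
  \sum_(n <- msupp q) x ^+ n *: f q@_n.

(** This replaces the substitution of an operator by that of a scalar, as soon
as [h] turns the operator into the scalar. *)
Lemma pol_subst_morph (W : zmodType) (N : lmodType PP) (D : W -> W)
    (f : A -> W) (x : PP) (h : {additive W -> N}) q :
    (forall w, h (D w) = x *: h w) ->
  h (pol_subst D f q) = lam_eval x (h \o f) q.
Proof.
move=> hD; rewrite raddf_sum; apply: eq_bigr => n _ /=.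
move: (f q@_n) => w; elim: n => [|n IH]; first by rewrite scale1r.
by rewrite hD IH exprS scalerA.
Qed.

Lemma lam_eval_const (q : M) : lam_eval lam lam_const q = q.
Proof.
rewrite /lam_eval [RHS]monalgE; apply: eq_bigr => n _.
apply/malgP=> k; rewrite coef_scale_const coefXn mcoeffU eq_sym.
by case: eqP => _; rewrite ?comp_polyC ?scale1r ?scale0r.
Qed.

Section LamEval.
Variables (N : lmodType PP) (x : PP) (f : {additive A -> N}).

Let D : {additive N -> N} := *:%R x.

Let lam_evalE q : lam_eval x f q = pol_subst D f q.
Proof.
apply: eq_bigr => n _; move: (f q@_n) => a; elim: n => [|n IH] /=.
  by rewrite scale1r.
by rewrite exprS -scalerA IH.
Qed.

Fact lam_eval_is_additive : zmod_morphism (lam_eval x f : M -> N).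
Proof. by move=> p q; rewrite !lam_evalE raddfB. Qed.

HB.instance Definition _ :=
  GRing.isZmodMorphism.Build M N (lam_eval x f : M -> N) lam_eval_is_additive.

Lemma lam_evalX (q : M) : lam_eval x f (lam *: q) = x *: lam_eval x f q.
Proof. by rewrite !lam_evalE lam_scale pol_substX. Qed.

Lemma lam_eval_pol_map (g : A -> A) (y : PP) (q : M) :
  (forall a, f (g a) = y *: f a) ->
  lam_eval x f (pol_map g q) = y *: lam_eval x f q.
Proof.
move=> fg; rewrite lam_evalE pol_subst_map /pol_subst scaler_sumr.
apply: eq_bigr => n _ /=; rewrite fg; move: (f _) => a.
elim: n => [|n IH] /=; first by rewrite scale1r.
by rewrite IH exprS -scalerA !scalerA mulrCA mulrA.
Qed.

End LamEval.

Section LamEvalSemilinear.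
Variables (N : lmodType PP) (x : PP) (f : {additive A -> N}).
Hypothesis fC : forall c a, f (c%:P *: a) = c%:P%:P *: f a.

Lemma lam_evalC c (q : M) : lam_eval x f (c%:P%:P *: q) = c%:P%:P *: lam_eval x f q.
Proof. by rewrite C_scale (@lam_eval_pol_map _ _ _ _ c%:P%:P). Qed.

Lemma lam_eval_pev p (q : M) :
  lam_eval x f (pev lam p *: q) = pev x p *: lam_eval x f q.
Proof.
by apply: (semilinear_poly (h := lam_eval x f)) lam_evalC (lam_evalX _ _) _ _.
Qed.

End LamEvalSemilinear.

(** The substitution of -lam-pd exchanges lam with mu - lam = -lam-pd and fixes
mu, which is why it is semilinear for the two kinds of coefficients that T_0
produces in a product. *)
Lemma subst_mlam_pdE q : subst_mlam_pd q = lam_eval (mu - lam) lam_const q.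
Proof.
exact: (pol_subst_morph (h := idfun : {additive M -> M}) _ _ mlam_pdE).
Qed.

Lemma lam_constC c a : lam_const (c%:P *: a) = c%:P%:P *: lam_const a.
Proof. by rewrite -lam_const_scale comp_polyC. Qed.

Lemma lam_const_pd a : lam_const (pd a) = - mu *: lam_const a.
Proof. by rewrite scaleNr -lam_const_scale comp_polyX scaleNr raddfN opprK. Qed.

Lemma subst_mlam_pd_lam p (q : M) :
  subst_mlam_pd (pev lam p *: q) = pev (mu - lam) p *: (subst_mlam_pd q : M).
Proof. by rewrite !subst_mlam_pdE lam_eval_pev //; apply: lam_constC. Qed.

Lemma subst_mlam_pd_mulam p (q : M) :
  subst_mlam_pd (pev (mu - lam) p *: q) = pev lam p *: (subst_mlam_pd q : M).
Proof.
rewrite !subst_mlam_pdE.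
apply: (semilinear_poly (h := lam_eval (mu - lam) lam_const)) => [c b|b].
  by apply: lam_evalC; apply: lam_constC.
rewrite scalerBl raddfB /= lam_evalX mu_scale_pd.
rewrite raddfN /= (lam_eval_pol_map _ _ lam_const_pd) scaleNr opprK -scalerBl.
by rewrite opprB addrC subrK.
Qed.

Lemma subst_mlam_pd_sum (I : finType) (q : I -> M) :
  subst_mlam_pd (\sum_i q i) = \sum_i (subst_mlam_pd (q i) : M).
Proof.
rewrite subst_mlam_pdE -[LHS]/((lam_eval _ _ : {additive M -> M}) _) raddf_sum.
by apply: eq_bigr => i _; rewrite subst_mlam_pdE.
Qed.

(** * Products and brackets of values of T_0 *)

Section Products.
Variables (mul : A -> A -> pol A).
Hypothesis mulP : is_lsca mul.

Lemma lsca_linear_additive (h : A -> M) :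
  (forall c a a', h (c%:P *: a + a') = c%:P%:P *: h a + h a') ->
  zmod_morphism h.
Proof.
by move=> hl a a'; rewrite addrC -scaleN1r -polyCN hl polyCN polyCN scaleN1r addrC.
Qed.

Fact mul_additivel b : zmod_morphism (fun a => mul a b : M).
Proof.
apply: lsca_linear_additive => c a a'; rewrite C_scale.
exact: lsca_linearl mulP _ _ _ _.
Qed.

Fact mul_additiver a : zmod_morphism (fun b => mul a b : M).
Proof.
apply: lsca_linear_additive => c b b'; rewrite C_scale.
exact: lsca_linearr mulP _ _ _ _.
Qed.

Let mull b : {additive A -> M} :=
  HB.pack (mul^~ b : A -> M) (GRing.isZmodMorphism.Build A M _ (mul_additivel b)).

Let mulr a : {additive A -> M} :=
  HB.pack (mul a : A -> M) (GRing.isZmodMorphism.Build A M _ (mul_additiver a)).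

Lemma mul_scalel p a b :
  mul ((p \Po - 'X) *: a) b = pev lam p *: (mul a b : M).
Proof.
apply: (semilinear_pd (h := mull b)) => [c a'|a'] /=.
  have := lsca_linearl mulP c a' 0 b; rewrite addr0 -C_scale => ->.
  by have -> : mul 0 b = 0 := raddf0 (mull b); rewrite addr0.
by rewrite (lsca_pdl mulP) -lam_scale scaleNr.
Qed.

Lemma mul_scaler p a b :
  mul a ((p \Po - 'X) *: b) = pev (mu - lam) p *: (mul a b : M).
Proof.
apply: (semilinear_pd (h := mulr a)) => [c b'|b'] /=.
  have := lsca_linearr mulP c a b' 0; rewrite addr0 -C_scale => ->.
  by have -> : mul a 0 = 0 := raddf0 (mulr a); rewrite addr0.
by rewrite (lsca_pdr mulP) -lam_scale opprB scalerBl mu_scale_pd opprK addrC.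
Qed.

Variables (m : nat) (r l : 'I_m -> A).

Lemma T0E (f : A -> {poly K}) : T0 r l f = \sum_(i < m) (f (r i) \Po - 'X) *: l i.
Proof.
rewrite /T0 /Tlam raddf_sum; apply: eq_bigr => i _ /=.
rewrite raddf_sum /= comp_polyE scaler_suml; apply: eq_bigr => k _.
have -> : iter k (@mlam_pd K A) (lam_const (l i)) = (mu - lam) ^+ k *: lam_const (l i).
  elim: (nat_of_ord k) => [|j IH]; rewrite ?scale1r //= IH mlam_pdE.
  by rewrite exprS scalerA.
rewrite pol_mapE ?scaler0 // coef_scale_const scalerA; congr (_ *: _).
rewrite -horner_coef0 horner_exp hornerD hornerN hornerX hornerC subr0.
by rewrite rmorphXn /= comp_polyX mul_polyC.
Qed.

Lemma mul_T0l f b :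
  mul (T0 r l f) b = \sum_(i < m) pev lam (f (r i)) *: (mul (l i) b : M).
Proof.
rewrite T0E -[LHS]/(mull b _) raddf_sum; apply: eq_bigr => i _.
exact: mul_scalel.
Qed.

Lemma mul_T0r f a :
  mul a (T0 r l f) = \sum_(i < m) pev (mu - lam) (f (r i)) *: (mul a (l i) : M).
Proof.
rewrite T0E -[LHS]/(mulr a _) raddf_sum; apply: eq_bigr => i _.
exact: mul_scaler.
Qed.

(** f_lam(r_i) comes from the first argument of the bracket and
g_{-lam-pd}(r_j) from the second one.  In the opposite product their roles are
swapped, and the substitution of -lam-pd swaps them back. *)
Lemma bracket_T0 f g : bracket mul (T0 r l f) (T0 r l g) =
  \sum_(i < m) \sum_(j < m) (pev lam (f (r i)) * pev (mu - lam) (g (r j)))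
     *: (bracket mul (l i) (l j) : M).
Proof.
rewrite /bracket mul_T0l mul_T0r subst_mlam_pd_sum -sumrB.
apply: eq_bigr => i _; rewrite mul_T0r scaler_sumr mul_T0l scaler_sumr.
rewrite subst_mlam_pd_sum -sumrB; apply: eq_bigr => j _.
by rewrite scalerBr -!scalerA subst_mlam_pd_mulam subst_mlam_pd_lam.
Qed.

End Products.

End LambdaModuleFacts.

(** * Linear maps *)

Section LinearMaps.
Variable K : fieldType.

Lemma comp_linear (U V W : lmodType K) (F : V -> W) (G : U -> V) :
  linear F -> linear G -> linear (F \o G).
Proof. by move=> Fl Gl c x y; rewrite /= Gl Fl. Qed.

Lemma linB (U V : lmodType K) (F : U -> V) : linear F ->
  forall x y, F (x - y) = F x - F y.
Proof. by move=> Fl x y; rewrite addrC -scaleN1r Fl scaleN1r addrC. Qed.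

Lemma id_linear (V : lmodType K) : linear (@id V).
Proof. by []. Qed.

(** For the total derivation, and for its commutation with one of its three
summands. *)
Lemma linear_add3 (U V : lmodType K) (D1 D2 D3 : U -> V) :
  linear D1 -> linear D2 -> linear D3 -> linear (fun x => D1 x + D2 x + D3 x).
Proof.
move=> D1l D2l D3l c x y; rewrite D1l D2l D3l.
by rewrite [X in X + _ = _]addrACA [LHS]addrACA -!scalerDr.
Qed.

Lemma commute_sum3 (W : lmodType K) (E D1 D2 D3 : W -> W) : linear E ->
    (forall x, E (D1 x) = D1 (E x)) -> (forall x, E (D2 x) = D2 (E x)) ->
    (forall x, E (D3 x) = D3 (E x)) ->
  forall x, E (D1 x + D2 x + D3 x) = D1 (E x) + D2 (E x) + D3 (E x).
Proof. by move=> El ED1 ED2 ED3 x; rewrite !(linD El) ED1 ED2 ED3. Qed.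

End LinearMaps.

(** * The triple tensor product and its three derivations *)

Section TripleTensor.
Variables (K : fieldType) (A : lmodType {poly K}).

Fact pd_linear : linear (@pd K A : vsp A -> vsp A).
Proof.
move=> c a b; rewrite /pd [LHS]scalerDr; congr (_ + _).
by rewrite [LHS]scalerA mulrC -scalerA.
Qed.

Fact pd1_linear : linear (@pd1 K A).
Proof.
exact: (tmap_linear (tmap_linear pd_linear (@id_linear K _)) (@id_linear K _)).
Qed.

Fact pd2_linear : linear (@pd2 K A).
Proof.
exact: (tmap_linear (tmap_linear (@id_linear K _) pd_linear) (@id_linear K _)).
Qed.

Fact pd3_linear : linear (@pd3 K A).
Proof. exact: (tmap_linear (@id_linear K _) pd_linear). Qed.

HB.instance Definition _ :=
  GRing.isLinear.Build K (AAA A) (AAA A) _ (@pd1 K A) pd1_linear.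

Lemma pd1_t3 (a b c : A) : pd1 (t3 a b c) = t3 (pd a) b c.
Proof.
rewrite /pd1 /t3 (tmap_tens (tmap_linear pd_linear (@id_linear K _)) (@id_linear K _)).
by rewrite (tmap_tens pd_linear (@id_linear K _)).
Qed.

Lemma pd2_t3 (a b c : A) : pd2 (t3 a b c) = t3 a (pd b) c.
Proof.
rewrite /pd2 /t3 (tmap_tens (tmap_linear (@id_linear K _) pd_linear) (@id_linear K _)).
by rewrite (tmap_tens (@id_linear K _) pd_linear).
Qed.

Lemma pd3_t3 (a b c : A) : pd3 (t3 a b c) = t3 a b (pd c).
Proof. by rewrite /pd3 /t3 (tmap_tens (@id_linear K _) pd_linear). Qed.

Lemma t3_linear1 (b c : A) : linear (fun a : vsp A => t3 a b c : AAA A).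
Proof. by move=> k a a'; rewrite /t3 !tens_linearl. Qed.

Lemma t3_linear2 (a c : A) : linear (fun b : vsp A => t3 a b c : AAA A).
Proof. by move=> k b b'; rewrite /t3 tens_linearr tens_linearl. Qed.

Lemma t3_linear3 (a b : A) : linear (fun c : vsp A => t3 a b c : AAA A).
Proof. by move=> k c c'; rewrite /t3 tens_linearr. Qed.

Lemma AAA_ind (P : AAA A -> Prop) :
  P 0 -> (forall x y, P x -> P y -> P (x + y)) -> (forall a b c : A, P (t3 a b c)) ->
  forall x, P x.
Proof.
move=> P0 PD Pt x; have [n [u [v ->]]] := tensorP x.
elim/big_ind: _ => // i _; have [n' [a [b ->]]] := tensorP (u i).
have tl := tens_linearl (U := AA A) (v i).
pose h : {linear AA A -> AAA A} := HB.pack (fun t : AA A => tens t (v i))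
  (GRing.isLinear.Build K (AA A) (AAA A) _ _ tl).
rewrite -[tens _ _]/(h _) raddf_sum.
by elim/big_ind: _ => // j _; apply: Pt.
Qed.

Lemma AAA_ext (W : lmodType K) (F G : AAA A -> W) : linear F -> linear G ->
  (forall a b c : A, F (t3 a b c) = G (t3 a b c)) -> forall x, F x = G x.
Proof.
move=> Fl Gl FG; elim/AAA_ind=> [|x y IHx IHy|//]; first by rewrite !lin0.
by rewrite (linD Fl) (linD Gl) IHx IHy.
Qed.

Lemma t3_sum1 (I : finType) (a : I -> A) b c :
  t3 (\sum_i a i) b c = \sum_i t3 (a i) b c.
Proof.
exact: (big_morph (fun a => t3 a b c) (linD (t3_linear1 b c)) (lin0 (t3_linear1 b c))).
Qed.

Lemma t3_sum2 (I : finType) a (b : I -> A) c :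
  t3 a (\sum_i b i) c = \sum_i t3 a (b i) c.
Proof.
exact: (big_morph (fun b => t3 a b c) (linD (t3_linear2 a c)) (lin0 (t3_linear2 a c))).
Qed.

Lemma pd12C (x : AAA A) : pd1 (pd2 x) = pd2 (pd1 x).
Proof.
move: x; apply: (@AAA_ext (AAA A)
  (@pd1 K A \o @pd2 K A) (@pd2 K A \o @pd1 K A)
  (comp_linear pd1_linear pd2_linear)
  (comp_linear pd2_linear pd1_linear)) => a b c.
apply: etrans (congr1 (@pd1 K A) (pd2_t3 a b c)) _.
apply: etrans (pd1_t3 a (pd b) c) _; apply: esym.
apply: etrans (congr1 (@pd2 K A) (pd1_t3 a b c)) _.
exact: pd2_t3 (pd a) b c.
Qed.

Lemma pd13C (x : AAA A) : pd1 (pd3 x) = pd3 (pd1 x).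
Proof.
move: x; apply: (@AAA_ext (AAA A)
  (@pd1 K A \o @pd3 K A) (@pd3 K A \o @pd1 K A)
  (comp_linear pd1_linear pd3_linear)
  (comp_linear pd3_linear pd1_linear)) => a b c.
apply: etrans (congr1 (@pd1 K A) (pd3_t3 a b c)) _.
apply: etrans (pd1_t3 a b (pd c)) _; apply: esym.
apply: etrans (congr1 (@pd3 K A) (pd1_t3 a b c)) _.
exact: pd3_t3 (pd a) b c.
Qed.

Lemma pd23C (x : AAA A) : pd2 (pd3 x) = pd3 (pd2 x).
Proof.
move: x; apply: (@AAA_ext (AAA A)
  (@pd2 K A \o @pd3 K A) (@pd3 K A \o @pd2 K A)
  (comp_linear pd2_linear pd3_linear)
  (comp_linear pd3_linear pd2_linear)) => a b c.
apply: etrans (congr1 (@pd2 K A) (pd3_t3 a b c)) _.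
apply: etrans (pd2_t3 a b (pd c)) _; apply: esym.
apply: etrans (congr1 (@pd3 K A) (pd2_t3 a b c)) _.
exact: pd3_t3 a (pd b) c.
Qed.

Definition eq_mod_pd (x y : AAA A) : Prop := exists z, x - y = pd_sum z.

Fact pd_sum_linear : linear (@pd_sum K A).
Proof.
exact: (linear_add3 pd1_linear pd2_linear pd3_linear).
Qed.

Lemma eq_mod_pd_refl x : eq_mod_pd x x.
Proof. by exists 0; rewrite subrr (lin0 pd_sum_linear). Qed.

Lemma eq_mod_pdD x y x' y' : eq_mod_pd x y -> eq_mod_pd x' y' -> eq_mod_pd (x + x') (y + y').
Proof.
move=> [z zE] [z' zE']; exists (z + z').
by rewrite (linD pd_sum_linear) -zE -zE' opprD addrACA.
Qed.

Lemma eq_mod_pdZ k x y : eq_mod_pd x y -> eq_mod_pd (k *: x) (k *: y).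
Proof.
move=> [z zE]; exists (k *: z).
by rewrite (linZ pd_sum_linear) -zE scalerBr.
Qed.

Lemma pd1_pd_sum (z : AAA A) : pd1 (pd_sum z) = pd_sum (pd1 z).
Proof. exact: (commute_sum3 pd1_linear (fun=> erefl) pd12C pd13C). Qed.

Lemma pd2_pd_sum (z : AAA A) : pd2 (pd_sum z) = pd_sum (pd2 z).
Proof.
exact: (commute_sum3 pd2_linear (fun x => esym (pd12C x))
  (fun=> erefl) pd23C).
Qed.

Lemma eq_mod_pd_pd1 x y : eq_mod_pd x y -> eq_mod_pd (pd1 x) (pd1 y).
Proof.
move=> [z zE]; exists (pd1 z).
by rewrite -pd1_pd_sum -zE (linB pd1_linear).
Qed.

Lemma eq_mod_pd_pd2 x y : eq_mod_pd x y -> eq_mod_pd (pd2 x) (pd2 y).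
Proof.
move=> [z zE]; exists (pd2 z).
by rewrite -pd2_pd_sum -zE (linB pd2_linear).
Qed.

Lemma eq_mod_pd_sym x y : eq_mod_pd x y -> eq_mod_pd y x.
Proof.
move=> [z zE]; exists (- z).
by rewrite -[- z]scaleN1r (linZ pd_sum_linear) -zE scaleN1r opprB.
Qed.

Lemma eq_mod_pd_trans y x z : eq_mod_pd x y -> eq_mod_pd y z -> eq_mod_pd x z.
Proof.
move=> [u uE] [v vE]; exists (u + v).
by rewrite (linD pd_sum_linear) -uE -vE addrA subrK.
Qed.

(** The reason why reconstruction works: the evaluation forgets pd2, but pd1 and
pd3 determine it modulo the total derivation. *)
Lemma eq_mod_pd_pd13 x : eq_mod_pd (- pd3 x - pd1 x) (pd2 x).
Proof.
exists (- x); rewrite -[- x]scaleN1r (linZ pd_sum_linear) scaleN1r /pd_sum.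
by rewrite [in RHS]opprD [in RHS]opprD [RHS]addrC addrA.
Qed.

End TripleTensor.

(** * Evaluation of the S-equation at two functionals *)

Section TensorEvaluation.
Variables (K : fieldType) (A : lmodType {poly K}).
Local Notation PP := {poly {poly K}}.
Local Notation M := (lam_mod A).
Local Notation lam := (lamP K).
Local Notation mu := (muP K).

Variables f g : A -> {poly K}.
Hypotheses (fP : is_cdual f) (gP : is_cdual g).

(* The tensor product is one of vector spaces over K, hence the restriction of
   scalars from K[mu] to K of the target. *)
Let phi2 (a b : vsp A) : vsp PP := pev lam (f a) * pev (mu - lam) (g b).

Definition eval_AA (t : AA A) : PP := tlift phi2 t.

Let phi3 (t : AA A) (c : vsp A) : vsp (mu_mod A) := eval_AA t *: lam_const c.

(** a (x) b (x) c |-> f_lam(a) g_{-lam-pd}(b) c, with -lam-pd written as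
mu - lam. *)
Definition eval_AAA (x : AAA A) : M := tlift phi3 x.

Lemma pev_cdual_lin (h : A -> {poly K}) z : is_cdual h ->
  linear (fun a : vsp A => pev z (h a) : vsp PP).
Proof.
move=> hP c a b; rewrite hP.1 rmorphD -mul_polyC rmorphM /= pevC.
by rewrite mul_polyC.
Qed.

Let phi2l b : linear (phi2^~ b).
Proof.
by move=> c a a'; rewrite /phi2 (pev_cdual_lin lam fP) mulrDl -scalerAl.
Qed.

Let phi2r a : linear (phi2 a).
Proof.
by move=> c b b'; rewrite /phi2 (pev_cdual_lin (mu - lam) gP) mulrDr -scalerAr.
Qed.

Lemma eval_AA_linear : linear (eval_AA : AA A -> vsp PP).
Proof. exact: tlift_linear. Qed.

Lemma eval_AA_tens a b : eval_AA (tens (a : vsp A) (b : vsp A)) =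
  pev lam (f a) * pev (mu - lam) (g b).
Proof. by rewrite /eval_AA (tlift_tens phi2l phi2r). Qed.

Lemma scale_vsp c (q : M) : c%:P%:P *: q = c *: (q : vsp (mu_mod A)).
Proof. exact: endo_modC. Qed.

Let phi3l c : linear (phi3^~ c).
Proof.
move=> k t t'; rewrite /phi3 eval_AA_linear scalerDl -scale_vsp scalerA.
by rewrite mul_polyC.
Qed.

Let phi3r t : linear (phi3 t).
Proof.
move=> k c c'; rewrite /phi3 raddfD /= scalerDr -scale_vsp lam_constC scalerA mulrC.
by rewrite -scalerA.
Qed.

Fact eval_AAA_linear : linear (eval_AAA : AAA A -> vsp (mu_mod A)).
Proof. exact: tlift_linear. Qed.

Fact eval_AAA_additive : zmod_morphism (eval_AAA : AAA A -> M).
Proof. exact: linB eval_AAA_linear. Qed.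

Lemma eval_AAA_t3 (a b c : A) :
  eval_AAA (t3 a b c) = (pev lam (f a) * pev (mu - lam) (g b)) *: lam_const c.
Proof.
by rewrite -eval_AA_tens; rewrite /eval_AAA (tlift_tens phi3l phi3r).
Qed.

Let evalA : {additive AAA A -> M} :=
  HB.pack eval_AAA (GRing.isZmodMorphism.Build (AAA A) M _ eval_AAA_additive).

Let scale_linear (P : PP) :
  linear (fun q : vsp (mu_mod A) => P *: (q : M) : vsp (mu_mod A)).
Proof. by move=> c q q'; rewrite -!scale_vsp scalerDr !scalerA mulrC. Qed.

Lemma eval_AAA_pd1 x : eval_AAA (pd1 x) = lam *: eval_AAA x.
Proof.
apply: (@AAA_ext K A (vsp (mu_mod A)) (eval_AAA \o @pd1 K A) _
  (comp_linear eval_AAA_linear (@pd1_linear K A))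
  (comp_linear (scale_linear lam) eval_AAA_linear)) => a b c.
apply: etrans (congr1 eval_AAA (pd1_t3 a b c)) _.
apply: etrans (eval_AAA_t3 (pd a) b c) _.
apply: etrans (esym (congr1 ( *:%R lam) (eval_AAA_t3 a b c))).
by rewrite fP.2 rmorphM /= pevX scalerA mulrA.
Qed.

Lemma eval_AAA_pd2 x : eval_AAA (pd2 x) = (mu - lam) *: eval_AAA x.
Proof.
apply: (@AAA_ext K A (vsp (mu_mod A)) (eval_AAA \o @pd2 K A) _
  (comp_linear eval_AAA_linear (@pd2_linear K A))
  (comp_linear (scale_linear (mu - lam)) eval_AAA_linear)) => a b c.
apply: etrans (congr1 eval_AAA (pd2_t3 a b c)) _.
apply: etrans (eval_AAA_t3 a (pd b) c) _.
apply: etrans (esym (congr1 ( *:%R (mu - lam)) (eval_AAA_t3 a b c))).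
by rewrite gP.2 rmorphM /= pevX scalerA mulrCA.
Qed.

Lemma eval_AAA_pd3 x : eval_AAA (pd3 x) = - mu *: eval_AAA x.
Proof.
apply: (@AAA_ext K A (vsp (mu_mod A)) (eval_AAA \o @pd3 K A) _
  (comp_linear eval_AAA_linear (@pd3_linear K A))
  (comp_linear (scale_linear (- mu)) eval_AAA_linear)) => a b c.
apply: etrans (congr1 eval_AAA (pd3_t3 a b c)) _.
apply: etrans (eval_AAA_t3 a b (pd c)) _.
apply: etrans (esym (congr1 ( *:%R (- mu)) (eval_AAA_t3 a b c))).
by rewrite lam_const_pd !scalerA mulrC.
Qed.

(** The three derivations become lam, mu - lam and -mu, which sum to 0. *)
Lemma eval_AAA_pd_sum x : eval_AAA (pd_sum x) = 0.
Proof.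
apply: etrans (linD eval_AAA_linear (pd1 x + pd2 x) (pd3 x)) _.
rewrite (linD eval_AAA_linear (pd1 x)).
apply: etrans (congr2 +%R (congr2 +%R (eval_AAA_pd1 x) (eval_AAA_pd2 x)) (eval_AAA_pd3 x)) _.
by rewrite -!scalerDl [lam + _]addrCA subrr addr0 subrr scale0r.
Qed.

Variable mul : A -> A -> pol A.
Hypothesis mulP : is_lsca mul.

(** sum_n lam^n c_n |-> sum_n x^n h_z(c_n) *)
Definition dual_eval (x z : PP) (h : A -> {poly K}) (q : pol A) : PP :=
  lam_eval (N := PP^o) x (pev z \o h) q.

Lemma LdualE h a b : Ldual mul a h b = - dual_eval lam (mu - lam) h (mul a b).
Proof.
congr (- _); apply: eq_bigr => n _ /=; rewrite -/(pev _ _); move: (pev _ _) => p.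
elim: n => [|n IH]; first by rewrite scale1r.
by rewrite exprS -scalerA -IH.
Qed.

Lemma dual_eval_comp x z y h q : dual_eval x z h q \Po y = dual_eval (x \Po y) (z \Po y) h q.
Proof.
rewrite /dual_eval /lam_eval raddf_sum; apply: eq_bigr => n _ /=.
by rewrite [_ *: _]/(_ * _) comp_polyM pev_comp rmorphXn.
Qed.

Section DualEval.
Variables (x z : PP) (h : A -> {poly K}).
Hypothesis hP : is_cdual h.

Fact pev_cdual_additive : zmod_morphism (pev z \o h : A -> PP^o).
Proof.
move=> a b /=; rewrite addrC -scaleN1r -polyCN hP.1 rmorphD scaleN1r rmorphN.
by rewrite addrC.
Qed.

Let hz : {additive A -> PP^o} := HB.pack (pev z \o h : A -> PP^o)
  (GRing.isZmodMorphism.Build A PP^o _ pev_cdual_additive).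

Let hzC c a : hz (c%:P *: a) = c%:P%:P *: hz a.
Proof. by rewrite /= (is_cdualZ hP) rmorphM /= pevC. Qed.

Lemma dual_eval_sum (I : finType) (p : I -> {poly K}) (q : I -> M) :
  dual_eval x z h (\sum_i pev lam (p i) *: q i) =
  \sum_i pev x (p i) * dual_eval x z h (q i).
Proof.
rewrite /dual_eval -[LHS]/((lam_eval x hz : {additive M -> PP^o}) _) raddf_sum.
by apply: eq_bigr => i _; rewrite [LHS](lam_eval_pev _ hzC).
Qed.

End DualEval.

Variables (m : nat) (r l : 'I_m -> A).

Definition conformal_S_lhs : AAA A :=
  \sum_(i < m) \sum_(j < m)
      pol_subst (@pd2 K A) (fun c => t3 c (r j) (l i)) (mul (l j) (r i))
  - \sum_(i < m) \sum_(j < m)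
      pol_subst (@pd1 K A) (fun c => t3 (r j) c (l i)) (mul (l j) (r i))
  - \sum_(i < m) \sum_(j < m)
      pol_subst (@pd1 K A) (fun c => t3 (r i) (r j) c) (bracket mul (l i) (l j)).

(** The element L^*(T_0 f)_lam g - L^*(T_0 g)_{-lam-pd} f of the conformal dual
with lam adjoined, as a function of its argument [b]. *)
Definition dual_side (b : A) : PP :=
  Ldual mul (T0 r l f) g b - dual_subst (Ldual mul (T0 r l g) f) b.

(** Applying T_0 coefficientwise amounts to letting mu act as -pd, which is the
action of mu on A[lam]. *)
Lemma T0_dual_side n :
  T0 r l (coef_lam dual_side n) = (\sum_i dual_side (r i) *: lam_const (l i) : pol A)@_n.
Proof.
rewrite T0E raddf_sum; apply: eq_bigr => i _.
by rewrite [RHS]coef_scale_const.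
Qed.

(** In the second term, -lam-pd is substituted for lam in the conformal dual,
where pd acts as -mu: this exchanges lam and mu - lam. *)
Lemma dual_sideE b : dual_side b =
  \sum_(j < m) pev (mu - lam) (g (r j)) * dual_eval (mu - lam) lam f (mul (l j) b)
  - \sum_(j < m) pev lam (f (r j)) * dual_eval lam (mu - lam) g (mul (l j) b).
Proof.
rewrite /dual_side /dual_subst !LdualE !mul_T0l // raddfN /= opprK addrC.
rewrite !dual_eval_sum //; congr (_ - _).
rewrite raddf_sum; apply: eq_bigr => i _.
rewrite [LHS]rmorphM /= opprK addrC pev_comp dual_eval_comp comp_polyX muBlam_comp.
by [].
Qed.

Let eval_AAA_sum2 (F : 'I_m -> 'I_m -> AAA A) :
  eval_AAA (\sum_i \sum_j F i j) = \sum_i \sum_j eval_AAA (F i j).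
Proof.
have eval_AAA_sum G : eval_AAA (\sum_(i < m) G i) = \sum_i eval_AAA (G i).
  exact: (big_morph eval_AAA (linD eval_AAA_linear) (lin0 eval_AAA_linear)).
by apply: etrans (eval_AAA_sum _) _; apply: eq_bigr => i _; apply: eval_AAA_sum.
Qed.

Lemma eval_S_first :
  eval_AAA (\sum_(i < m) \sum_(j < m)
      pol_subst (@pd2 K A) (fun c => t3 c (r j) (l i)) (mul (l j) (r i))) =
  \sum_i \sum_j (pev (mu - lam) (g (r j)) *
    dual_eval (mu - lam) lam f (mul (l j) (r i))) *: lam_const (l i).
Proof.
apply: etrans (eval_AAA_sum2 _) _; apply: eq_bigr => i _; apply: eq_bigr => j _.
apply: etrans (pol_subst_morph (h := evalA) _ _ eval_AAA_pd2) _.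
rewrite mulr_sumr scaler_suml; apply: eq_bigr => n _.
apply: etrans (congr1 _ (eval_AAA_t3 _ _ _)) _.
by rewrite scalerA [in RHS]mulrC -mulrA.
Qed.

Lemma eval_S_second :
  eval_AAA (\sum_(i < m) \sum_(j < m)
      pol_subst (@pd1 K A) (fun c => t3 (r j) c (l i)) (mul (l j) (r i))) =
  \sum_i \sum_j (pev lam (f (r j)) *
    dual_eval lam (mu - lam) g (mul (l j) (r i))) *: lam_const (l i).
Proof.
apply: etrans (eval_AAA_sum2 _) _; apply: eq_bigr => i _; apply: eq_bigr => j _.
apply: etrans (pol_subst_morph (h := evalA) _ _ eval_AAA_pd1) _.
rewrite mulr_sumr scaler_suml; apply: eq_bigr => n _.
apply: etrans (congr1 _ (eval_AAA_t3 _ _ _)) _.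
by rewrite scalerA mulrCA.
Qed.

Lemma eval_S_third :
  eval_AAA (\sum_(i < m) \sum_(j < m)
      pol_subst (@pd1 K A) (fun c => t3 (r i) (r j) c) (bracket mul (l i) (l j))) =
  bracket mul (T0 r l f) (T0 r l g).
Proof.
rewrite bracket_T0 //.
apply: etrans (eval_AAA_sum2 _) _; apply: eq_bigr => i _; apply: eq_bigr => j _.
apply: etrans (pol_subst_morph (h := evalA) _ _ eval_AAA_pd1) _.
rewrite -[in RHS](lam_eval_const (bracket _ _ _)) scaler_sumr.
apply: eq_bigr => n _; apply: etrans (congr1 _ (eval_AAA_t3 _ _ _)) _.
by rewrite !scalerA mulrC.
Qed.

(** Evaluation at [f] and [g] carries the S-equation to the operator identity:
the first two sums give T_0 of the dual side, and the third one the bracket. *)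
Lemma eval_conformal_S_lhs : eval_AAA conformal_S_lhs =
  \sum_i dual_side (r i) *: lam_const (l i) - bracket mul (T0 r l f) (T0 r l g).
Proof.
have evalB x y z : eval_AAA (x - y - z) = eval_AAA x - eval_AAA y - eval_AAA z.
  by rewrite !(linB eval_AAA_linear).
apply: etrans (evalB _ _ _) _.
apply: etrans (congr2 (fun x y => x - y)
  (congr2 (fun x y => x - y) eval_S_first eval_S_second) eval_S_third) _.
rewrite -sumrB; congr (_ - _); apply: eq_bigr => i _.
by rewrite dual_sideE scalerBl !scaler_suml.
Qed.

End TensorEvaluation.

(** * Dual bases and reconstruction modulo the total derivation *)

Section DualBasis.
Variables (K : fieldType) (A : lmodType {poly K}).

Section Combination.
Variables (I : choiceType) (e : I -> A).

Let comb (p : {malg {poly K}[I]}) : A := \sum_(i <- msupp p) p@_i *: e i.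

Let combEw (d : {fset I}) (p : {malg {poly K}[I]}) :
  (msupp p `<=` d)%fset -> comb p = \sum_(i <- d) p@_i *: e i.
Proof.
move=> sd; apply: big_fset_incl => // i _ ip.
by rewrite mcoeff_outdom // scale0r.
Qed.

Lemma combination_linear c p q :
  \sum_(i <- msupp (c *: p + q)) (c *: p + q)@_i *: e i =
  c *: (\sum_(i <- msupp p) p@_i *: e i) + \sum_(i <- msupp q) q@_i *: e i.
Proof.
set d := (msupp p `|` msupp q `|` msupp (c *: p + q))%fset.
rewrite -!/(comb _) !(@combEw d) ?fsubsetUr //.
- rewrite scaler_sumr -big_split; apply: eq_bigr => i _ /=.
  by rewrite mcoeffD mcoeffZ scalerDl scalerA.
- by rewrite /d fsetUAC; apply: fsubsetUr.
- by rewrite /d -!fsetUA; apply: fsubsetUl.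
Qed.

End Combination.

(** The coordinates of the finitely many generators have finite supports, so
finitely many basis elements already span. *)
Lemma free_dual_basis : finitely_generated A -> is_free A ->
  exists (n : nat) (e : 'I_n -> A) (es : 'I_n -> A -> {poly K}),
    (forall i, is_cdual (es i)) /\ forall a, a = \sum_i es i a *: e i.
Proof.
move=> [n [g gP]] [I [e /choice[coord coordP]]].
have coord_lin c a b : coord (c *: a + b) = c *: coord a + coord b.
  apply: (coordP _).2; rewrite combination_linear.
  by rewrite -(coordP a).1 -(coordP b).1.
have coordD a b : coord (a + b) = coord a + coord b.
  by rewrite -[a]scale1r coord_lin !scale1r.
have coord0 : coord 0 = 0.
  by apply: (addIr (coord 0)); rewrite -coordD !add0r.
have coordZ c a : coord (c *: a) = c *: coord a.
  by rewrite -[c *: a]addr0 coord_lin coord0 addr0.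
pose D : {fset I} := (\bigcup_(k <- enum 'I_n) msupp (coord (g k)))%fset.
have supD a : (msupp (coord a) `<=` D)%fset.
  apply/fsubsetP=> i; apply: contraTT => iD.
  rewrite -mcoeff_eq0; have [p ->] := gP a.
  rewrite (big_morph coord coordD coord0) raddf_sum big1 // => k _.
  rewrite /= coordZ mcoeffZ mcoeff_outdom ?mulr0 //; apply: contra iD => ik.
  by apply/bigfcupP; exists k; rewrite // mem_enum.
pose s := in_tuple D.
exists (size D), (fun i => e (tnth s i)), (fun i a => (coord a)@_(tnth s i)).
split=> [i|a].
  split=> [c a b|a]; first by rewrite coord_lin mcoeffD mcoeffZ mul_polyC.
  by rewrite /pd coordZ mcoeffZ.
rewrite {1}(coordP a).1 -(big_tnth _ _ D xpredT (fun i => (coord a)@_i *: e i)).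
by apply: big_fset_incl => // i _ ip; rewrite mcoeff_outdom // scale0r.
Qed.

End DualBasis.

Section TotalDerivation.
Variables (K : fieldType) (A : lmodType {poly K}).
Local Notation PP := {poly {poly K}}.
Local Notation M := (lam_mod A).
Local Notation lam := (lamP K).
Local Notation mu := (muP K).

Section Reconstruction.
Variables a b : A.

Let t3_additive : zmod_morphism (@t3 K A a b) := linB (t3_linear3 a b).

Let t3ab : {additive A -> AAA A} := HB.pack (@t3 K A a b)
  (GRing.isZmodMorphism.Build A (AAA A) _ t3_additive).

(** sum_n lam^n c_n |-> sum_n pd1^n (a (x) b (x) c_n), the candidate for an
inverse of evaluation. *)
Definition rebuild (q : M) : AAA A := pol_subst (@pd1 K A) (@t3 K A a b) q.

Fact rebuild_additive : zmod_morphism rebuild.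
Proof. by move=> p q; apply: (raddfB (pol_subst _ t3ab)). Qed.

HB.instance Definition _ := GRing.isZmodMorphism.Build M (AAA A) rebuild rebuild_additive.

Lemma rebuild_lam q : rebuild (lam *: q) = pd1 (rebuild q).
Proof. by rewrite lam_scale; apply: (pol_substX _ t3ab). Qed.

Lemma rebuild_map (h : A -> A) (H : AAA A -> AAA A) : linear H ->
    (forall c, t3 a b (h c) = H (t3 a b c)) -> (forall x, pd1 (H x) = H (pd1 x)) ->
  forall q : pol A, rebuild (pol_map h q) = H (rebuild q).
Proof.
move=> Hl hH HC q; apply: etrans (pol_subst_map _ t3ab _ _) _.
rewrite /rebuild /pol_subst (big_morph H (linD Hl) (lin0 Hl)).
apply: eq_bigr => n _ /=; rewrite hH; move: (t3 a b _) => t.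
by elim: n => [//|n IH] /=; rewrite IH HC.
Qed.

Lemma rebuildC k q : rebuild (k%:P%:P *: q) = k *: rebuild q.
Proof.
rewrite C_scale (rebuild_map (H := *:%R k)) // => [c x y|c|x].
- by rewrite scalerDr !scalerA mulrC.
- exact: (linZ (t3_linear3 a b) k c).
exact: (linZ (@pd1_linear K A)).
Qed.

Lemma rebuild_mu q : rebuild (mu *: q) = - pd3 (rebuild q).
Proof.
rewrite mu_scale_pd raddfN; congr (- _).
apply: (rebuild_map (@pd3_linear K A)) => [c|x]; first exact/esym/pd3_t3.
exact: pd13C.
Qed.

Lemma rebuild_const c : rebuild (lam_const c) = t3 a b c.
Proof. exact: (pol_substU _ t3ab). Qed.

End Reconstruction.

(** lam returns to the first derivation and mu - lam to minus the sum of the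
first and the third, that is, modulo the total derivation, to the second. *)
Lemma rebuild_t3 (a b c : A) p q :
  eq_mod_pd (rebuild a b ((pev lam p * pev (mu - lam) q) *: lam_const c))
    (t3 (p *: a) (q *: b) c).
Proof.
have t3E1 s k w : t3 ((s * 'X + k%:P) *: a) w c =
    pd1 (t3 (s *: a) w c) + k *: t3 a w c.
  rewrite scalerDl mulrC -scalerA.
  apply: etrans (linD (t3_linear1 w c) (pd (s *: a)) (k%:P *: a)) _.
  by rewrite (pd1_t3 (s *: a)) (linZ (t3_linear1 w c) k a).
have t3E2 s k : t3 a ((s * 'X + k%:P) *: b) c =
    pd2 (t3 a (s *: b) c) + k *: t3 a b c.
  rewrite scalerDl mulrC -scalerA.
  apply: etrans (linD (t3_linear2 a c) (pd (s *: b)) (k%:P *: b)) _.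
  by rewrite (pd2_t3 a (s *: b)) (linZ (t3_linear2 a c) k b).
have pevE z s k : pev z (s * 'X + k%:P) = z * pev z s + k%:P%:P :> PP.
  by rewrite rmorphD rmorphM /= pevC pevX mulrC.
elim/poly_ind: p => [|p k IHp].
  rewrite rmorph0 mul0r !scale0r raddf0 (lin0 (t3_linear1 _ _)).
  exact: eq_mod_pd_refl.
rewrite t3E1 pevE mulrDl scalerDl raddfD /= -mulrA -scalerA rebuild_lam.
apply: eq_mod_pdD; first exact: eq_mod_pd_pd1.
rewrite -scalerA rebuildC; apply: eq_mod_pdZ.
elim/poly_ind: q {IHp} => [|q j IHq].
  rewrite rmorph0 !scale0r raddf0 (lin0 (t3_linear2 _ _)).
  exact: eq_mod_pd_refl.
rewrite t3E2 pevE scalerDl raddfD /=; apply: eq_mod_pdD; last first.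
  by rewrite rebuildC rebuild_const; apply: eq_mod_pd_refl.
rewrite -scalerA scalerBl raddfB /= rebuild_mu rebuild_lam.
exact: eq_mod_pd_trans (eq_mod_pd_pd13 _) (eq_mod_pd_pd2 IHq).
Qed.

(** On a (x) b (x) c, expand a and b in the dual basis and apply [rebuild_t3] to
the coefficients e'_i(a) and e'_j(b). *)
Lemma eq_mod_pd_reconstruct (n : nat) (e : 'I_n -> A) (es : 'I_n -> A -> {poly K}) :
    (forall i, is_cdual (es i)) -> (forall a, a = \sum_i es i a *: e i) ->
  forall x : AAA A,
    eq_mod_pd x (\sum_i \sum_j rebuild (e i) (e j) (eval_AAA (es i) (es j) x)).
Proof.
move=> esP eE.
pose G i j x := rebuild (e i) (e j) (eval_AAA (es i) (es j) x).
have GD i j x y : G i j (x + y) = G i j x + G i j y.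
  rewrite /G -raddfD; congr rebuild.
  exact: (linD (eval_AAA_linear (esP i) (esP j))).
have G0 i j : G i j 0 = 0.
  by rewrite /G (lin0 (eval_AAA_linear (esP i) (esP j))) raddf0.
rewrite -/(forall x, eq_mod_pd x (\sum_i \sum_j G i j x)).
elim/AAA_ind=> [|x y IHx IHy|a b c].
- rewrite big1 => [|i _]; first exact: eq_mod_pd_refl.
  by apply: big1 => j _; apply: G0.
- have -> : \sum_i \sum_j G i j (x + y) =
      \sum_i \sum_j G i j x + \sum_i \sum_j G i j y.
    rewrite -big_split; apply: eq_bigr => i _.
    by rewrite -big_split; apply: eq_bigr => j _; apply: GD.
  exact: eq_mod_pdD IHx IHy.
have eq_mod_pd_sum (u v : 'I_n -> AAA A) :
    (forall i, eq_mod_pd (u i) (v i)) -> eq_mod_pd (\sum_i u i) (\sum_i v i).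
  move=> uv; apply: (big_ind2 (@eq_mod_pd K A)) => [|u1 u2 v1 v2 uv1 uv2|i _].
  - exact: eq_mod_pd_refl.
  - exact: eq_mod_pdD.
  exact: uv.
have tE : t3 a b c = \sum_i \sum_j t3 (es i a *: e i) (es j b *: e j) c.
  rewrite {1}(eE a) {1}(eE b) t3_sum1; apply: eq_bigr => i _.
  exact: t3_sum2.
rewrite [X in eq_mod_pd X _]tE; apply: (eq_mod_pd_sum) => i; apply: (eq_mod_pd_sum) => j.
rewrite /G (eval_AAA_t3 (esP i) (esP j)); apply: eq_mod_pd_sym; exact: rebuild_t3.
Qed.

End TotalDerivation.

(** * The conformal S-equation and the operator identity *)

Theorem theorem5p1 (R : realType) (A : lmodType {poly R[i]})
    (mul : A -> A -> pol A) (Alsca : is_lsca mul)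
    (Afin : finitely_generated A) (Afree : is_free A)
    (r : AA A) (m : nat) (r_ l_ : 'I_m -> A)
    (rE : r = \sum_(i < m) tens (r_ i : vsp A) (l_ i : vsp A))
    (r_sym : r = \sum_(i < m) tens (l_ i : vsp A) (r_ i : vsp A)) :
  conformal_S_equation mul r_ l_ <->
  (forall f g : A -> {poly R[i]}, is_cdual f -> is_cdual g ->
    forall n : nat,
      (bracket mul (T0 r_ l_ f) (T0 r_ l_ g))@_n
      = T0 r_ l_ (coef_lam (fun b =>
          Ldual mul (T0 r_ l_ f) g b
          - dual_subst (Ldual mul (T0 r_ l_ g) f) b) n)).
Proof.
(* For fixed functionals, the operator identity is the vanishing of the
   evaluated S-equation. *)
have key f g (fP : is_cdual f) (gP : is_cdual g) :
  (forall n, (bracket mul (T0 r_ l_ f) (T0 r_ l_ g))@_n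
     = T0 r_ l_ (coef_lam (dual_side f g mul r_ l_) n)) <->
  eval_AAA f g (conformal_S_lhs mul r_ l_) = 0.
  rewrite eval_conformal_S_lhs //; split=> [H|/eqP]; last first.
    by rewrite subr_eq0 => /eqP <- n; rewrite T0_dual_side.
  apply/eqP; rewrite subr_eq0; apply/eqP/malgP=> n.
  by rewrite -T0_dual_side H.
split=> [[x xE] f g fP gP|H].
  by apply/(key f g fP gP); rewrite /conformal_S_lhs xE eval_AAA_pd_sum.
have [n [e [es [esP eE]]]] := free_dual_basis Afin Afree.
have [x] := eq_mod_pd_reconstruct esP eE (conformal_S_lhs mul r_ l_).
have -> : \sum_i \sum_j rebuild (e i) (e j)
    (eval_AAA (es i) (es j) (conformal_S_lhs mul r_ l_)) = 0.
  apply: big1 => i _; apply: big1 => j _.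
  by rewrite (iffLR (key _ _ (esP i) (esP j)) (H _ _ (esP i) (esP j))) raddf0.
by rewrite subr0 => xE; exists x; apply: xE.
Qed.
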